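(* Let $A_5(n)$ be defined by $\sum_{n\ge 0}A_5(n)q^n=\dfrac{f_5^{10}}{f_1^2}$, and let $\{B_k\}_{k\ge 0}$ be defined by $B_0=0$, $B_1=1$ and $B_k=-4B_{k-1}-8B_{k-2}+\dfrac{8^k-1}{7}$ for $k\ge 2$. Then for every integer $k\ge 1$, \[ \sum_{n=-1}^\infty A_5(2^kn+2^{k+1}-2)q^n = B_k\frac{f_1^4f_5^4}{q}-8B_{k-1}f_2^4f_{10}^4+\frac{8^{k+1}-1}{7}\cdot\frac{f_5^{10}}{f_1^2}-\frac{8^{k+1}-8}{7}\cdot \frac{q^2f_{10}^{10}}{f_2^2} \] as formal power series (Laurent series) in $q$.
   Context: For $m\in\mathbb{N}$ and $|q|<1$, $f_m:=\prod_{n\ge1}(1-q^{mn})$. $A_5(n)$ is the number of partition pairs of $n$ with $5$-cores, i.e. pairs $(\lambda,\mu)$ of $5$-core partitions (no hook length divisible by $5$) whose parts sum in total to $n$; its generating function is $\sum_{n\ge0}A_5(n)q^n=f_5^{10}/f_1^2$, with $A_5(0)=1$. *)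

(* Defs.v *)
From mathcomp Require Import all_boot all_order all_algebra.
Set Implicit Arguments. Unset Strict Implicit. Unset Printing Implicit Defensive.
Import Order.TTheory GRing.Theory Num.Theory.
Local Open Scope ring_scope.

Definition pser := nat -> rat.

Definition psmul (f g : pser) : pser :=
  fun n => \sum_(i < n.+1) f i * g (n - i)%N.

Definition psone : pser := fun n => if n is 0%N then 1 else 0.

Fixpoint pspow (f : pser) (k : nat) : pser :=
  match k with 0%N => psone | k'.+1 => psmul f (pspow f k') end.

(* multiplicative inverse of a power series with nonzero constant term,
   computed by the usual recursion on coefficients *)
Fixpoint psinv_aux (f : pser) (n : nat) : seq rat :=
  match n with
  | 0%N => [:: (f 0%N)^-1]
  | n'.+1 => let s := psinv_aux f n' in
      rcons s (- (f 0%N)^-1 * \sum_(1 <= i < n.+1) f i * nth 0 s (n - i)%N)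
  end.
Definition psinv (f : pser) : pser := fun n => nth 0 (psinv_aux f n) n.

Definition psdiv (f g : pser) : pser := psmul f (psinv g).

(* f_m = prod_{n>=1} (1 - q^{m n}); for m >= 1 the coefficient of q^N only
   depends on the factors with n <= N. *)
Definition fm (m : nat) : pser :=
  fun N => (\prod_(1 <= j < N.+1) (1 - 'X^(m * j)) : {poly rat})`_N.

Definition qcoef (f : pser) (n : int) : rat :=
  if n is Posz m then f m else 0.

Definition A5gf : pser := psdiv (pspow (fm 5) 10) (pspow (fm 1) 2).
Definition A5 (n : nat) : rat := A5gf n.

Fixpoint B (k : nat) : rat :=
  match k with
  | 0%N => 0
  | 1%N => 1
  | (j.+1 as i).+1 => -4 * B i - 8 * B j + (8 ^+ k - 1) / 7
  end.

(* Main.v *)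
Require Import Defs.
From HB Require Import structures.
From mathcomp Require Import all_boot all_order all_algebra.
From mathcomp Require Import boolp classical_sets functions fsbigop.
From mathcomp Require Import ring lra zify.
Set Implicit Arguments. Unset Strict Implicit. Unset Printing Implicit Defensive.
Import Order.TTheory GRing.Theory Num.Theory.
Local Open Scope ring_scope.

(** Put F = q f_1^4 f_5^4 and H = q^2 f_5^10 / f_1^2, both of weight 4 and level 5, and
    write U for the extraction of even coefficients and V for q -> q^2.  The theorem is
    the k-th iterate of
      U H = F + 9 H - 8 V H   and   U F = - 4 F - 8 V F.
    As 2 V U f = f(q) + f(-q), and f_m(-q) = f_{2m}^3 / (f_m f_{4m}) for odd m, these are
    identities between eta quotients of level 20.  They follow algebraically from
      psi(q)^2 - q psi(q^5)^2 = f_2 f_5^3 / (f_1 f_10),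
      phi(q)^2 - phi(q^5)^2 = 4 q f_2^2 f_5 f_20 / (f_1 f_4),
    psi(q) = f_2^2 / f_1, phi(q) = f_2^5 / (f_1 f_4)^2, and from what q -> -q makes of them.
    The squares of theta functions are sums of q^N(w) over w in a rotation-invariant subset
    of Z[i].  The w divisible by 2 + i give the square at q^5; multiplication by i permutes
    the four other classes modulo 2 + i, and one class gives, by Jacobi's triple product,
    the infinite product on the right. *)

(** * The integral domain of formal power series *)

HB.instance Definition _ := gen_eqMixin pser.
HB.instance Definition _ := gen_choiceMixin pser.

Definition psadd (f g : pser) : pser := fun n => f n + g n.
Definition psopp (f : pser) : pser := fun n => - f n.
Definition pszero : pser := fun=> 0.

Lemma psaddA : associative psadd.
Proof. by move=> f g h; apply/funext=> n; apply: addrA. Qed.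
Lemma psaddC : commutative psadd.
Proof. by move=> f g; apply/funext=> n; apply: addrC. Qed.
Lemma psadd0 : left_id pszero psadd.
Proof. by move=> f; apply/funext=> n; apply: add0r. Qed.
Lemma psaddN : left_inverse pszero psopp psadd.
Proof. by move=> f; apply/funext=> n; apply: addNr. Qed.

HB.instance Definition _ := GRing.isZmodule.Build pser psaddA psaddC psadd0 psaddN.

(** Coefficients up to [N] of a product depend only on the truncations, so associativity and
    commutativity of [psmul] are inherited from polynomials. *)
Definition trunc (N : nat) (f : pser) : {poly rat} := \poly_(i < N.+1) f i.

Lemma coef_trunc N f n : (n <= N)%N -> (trunc N f)`_n = f n.
Proof. by move=> le_nN; rewrite coef_poly ltnS le_nN. Qed.

Lemma coef_psmul N f g n : (n <= N)%N -> psmul f g n = (trunc N f * trunc N g)`_n.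
Proof.
move=> le_nN; rewrite coefM; apply: eq_bigr => i _.
by rewrite !coef_trunc // ?(leq_trans _ le_nN) ?leq_subr ?leq_ord.
Qed.

Lemma psmulA : associative psmul.
Proof.
move=> f g h; apply/funext=> n.
transitivity (trunc n f * (trunc n g * trunc n h))`_n.
  rewrite coefM; apply: eq_bigr => i _.
  by rewrite coef_trunc ?leq_ord // (coef_psmul _ _ (leq_subr i n)).
rewrite mulrA coefM; apply: eq_bigr => i _.
by rewrite coef_trunc ?leq_subr // -(coef_psmul _ _ (leq_ord i)).
Qed.

Lemma psmulC : commutative psmul.
Proof. by move=> f g; apply/funext=> n; rewrite !(coef_psmul _ _ (leqnn n)) mulrC. Qed.

Lemma psmul1 : left_id psone psmul.
Proof.
move=> f; apply/funext=> n; rewrite /psmul big_ord_recl /= mul1r subn0.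
by rewrite big1 ?addr0 // => i _; rewrite /= mul0r.
Qed.

Lemma psmulDl : left_distributive psmul psadd.
Proof.
move=> f g h; apply/funext=> n; rewrite /psmul /psadd -big_split /=.
by apply: eq_bigr => i _; rewrite mulrDl.
Qed.

Lemma psone_neq0 : psone != pszero.
Proof. by apply/eqP=> /(congr1 (fun f : pser => f 0%N))/eqP; rewrite /= oner_eq0. Qed.

HB.instance Definition _ :=
  GRing.Zmodule_isComNzRing.Build pser psmulA psmulC psmul1 psmulDl psone_neq0.

Lemma psD (f g : pser) n : (f + g) n = f n + g n. Proof. by []. Qed.
Lemma psN (f : pser) n : (- f) n = - f n. Proof. by []. Qed.
Lemma psB (f g : pser) n : (f - g) n = f n - g n. Proof. by []. Qed.
Lemma ps0 n : (0 : pser) n = 0. Proof. by []. Qed.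
Lemma psM (f g : pser) n : (f * g) n = \sum_(i < n.+1) f i * g (n - i)%N.
Proof. by []. Qed.
Lemma psM0 (f g : pser) : (f * g) 0%N = f 0%N * g 0%N.
Proof. by rewrite psM big_ord1. Qed.
Lemma ps_natrM k (f : pser) n : (k%:R * f) n = k%:R * f n.
Proof. by elim: k => [|k IH]; rewrite ?mul0r // !mulrS !mulrDl !mul1r psD IH. Qed.
Lemma pspowE f k : pspow f k = f ^+ k.
Proof. by elim: k => [|k IH] //=; rewrite exprS IH. Qed.
Lemma psX0 (f : pser) k : (f ^+ k) 0%N = f 0%N ^+ k.
Proof. by elim: k => [|k IH]; rewrite ?expr0 // !exprS psM0 IH. Qed.
Lemma ps_sum (I : Type) (r : seq I) (P : pred I) (F : I -> pser) n :
  (\sum_(i <- r | P i) F i) n = \sum_(i <- r | P i) F i n.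
Proof. exact: (big_morph (fun f : pser => f n)). Qed.

(** * Inverses, units and absence of zero divisors *)

Lemma size_psinv_aux f n : size (psinv_aux f n) = n.+1.
Proof. by elim: n => //= n IH; rewrite size_rcons IH. Qed.

Lemma nth_psinv_aux f n m : (m <= n)%N -> nth 0 (psinv_aux f n) m = psinv f m.
Proof.
elim: n => [|n IH]; first by rewrite leqn0 => /eqP ->.
rewrite leq_eqVlt => /orP[/eqP -> //|]; rewrite ltnS => le_mn.
by rewrite /= nth_rcons size_psinv_aux ltnS le_mn IH.
Qed.

Lemma psinvS f n : psinv f n.+1 =
  - (f 0%N)^-1 * \sum_(i < n.+1) f i.+1 * psinv f (n - i)%N.
Proof.
rewrite {1}/psinv /= nth_rcons size_psinv_aux ltnn eqxx.
congr (_ * _); rewrite big_add1 /= big_mkord; apply: eq_bigr => i _.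
by rewrite subSS nth_psinv_aux ?leq_subr.
Qed.

Lemma mulps_inv (f : pser) : f 0%N != 0 -> f * psinv f = 1.
Proof.
move=> f0; apply/funext=> -[|n].
  by rewrite psM0 /psinv /= mulfV.
rewrite psM big_ord_recl subn0 psinvS mulrA mulrN mulfV // mulN1r.
apply/eqP; rewrite addrC subr_eq0; apply/eqP; apply: eq_bigr => i _.
by rewrite lift0 subSS.
Qed.

Definition psunit : pred pser := fun f => f 0%N != 0.
Definition psinvr (f : pser) : pser := if psunit f then psinv f else f.

Lemma psmulVr : {in psunit, left_inverse 1 psinvr *%R}.
Proof. by move=> f uf; rewrite /psinvr ifT // mulrC mulps_inv. Qed.
Lemma psunitP (f g : pser) : g * f = 1 -> psunit f.
Proof.
move=> gf1; have := congr1 (fun h : pser => h 0%N) gf1.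
rewrite psM0 /psunit => e; apply: contra_eqN e => /eqP ->.
by rewrite mulr0 eq_sym oner_eq0.
Qed.
Lemma psinvr_out : {in [predC psunit], psinvr =1 id}.
Proof.
move=> f /negbTE uf; rewrite /psinvr; case: ifP => //.
by rewrite -[psunit f]/(f \in psunit) uf.
Qed.

HB.instance Definition _ :=
  GRing.ComNzRing_hasMulInverse.Build pser psmulVr psunitP psinvr_out.

(** The lowest nonzero coefficients, at [m] and [n], multiply to the coefficient of the product at
    [m + n]. *)
Lemma ps_mulf_eq0 (f g : pser) : f * g = 0 -> (f == 0) || (g == 0).
Proof.
move=> fg0; apply/negPn; rewrite negb_or; apply/negP => /andP[f0 g0].
have low (h : pser) : h != 0 -> exists m, h m != 0 /\ forall i, (i < m)%N -> h i = 0.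
  move=> h0; have ex : exists m, h m != 0.
    apply/not_existsP => hz; case/eqP: h0; apply/funext => n.
    by have /negP := hz n; rewrite negbK => /eqP.
  exists (ex_minn ex); case: ex_minnP => m hm mmin; split=> // i lt_im.
  by apply/eqP; apply: contraLR lt_im => /mmin; rewrite -leqNgt.
have [m [fm fl]] := low f f0; have [n [gn gl]] := low g g0.
have := congr1 (fun h : pser => h (m + n)%N) fg0; rewrite psM ps0.
have lt_m : (m < (m + n).+1)%N by rewrite ltnS leq_addr.
rewrite (bigD1 (Ordinal lt_m)) //= addKn big1 ?addr0; last first.
  move=> i ne_i; have [lt_im|lt_mi|eq_im] := ltngtP i m.
  - by rewrite fl ?mul0r.
  - by rewrite gl ?mulr0 //; have := ltn_ord i; lia.
  - by case/eqP: ne_i; apply: val_inj.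
by apply/eqP; rewrite mulf_neq0.
Qed.

HB.instance Definition _ :=
  GRing.ComUnitRing_isIntegral.Build pser ps_mulf_eq0.

(** * Infinite products *)

Definition psq : pser := fun n => (n == 1)%N%:R.

Lemma psqM f n : (psq * f) n = if n is n'.+1 then f n' else 0.
Proof.
case: n => [|n]; first by rewrite psM0 mul0r.
rewrite psM big_ord_recl mul0r add0r big_ord_recl /= mul1r subSS subn0.
by rewrite big1 ?addr0 // => i _; rewrite mul0r.
Qed.

Lemma psqXM k f n : (psq ^+ k * f) n = if (k <= n)%N then f (n - k)%N else 0.
Proof.
elim: k n => [|k IH] n; first by rewrite expr0 mul1r subn0.
by rewrite exprS -mulrA psqM; case: n => [|n] //; rewrite IH ltnS subSS.
Qed.

Lemma psqX k n : (psq ^+ k) n = (n == k)%:R.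
Proof.
rewrite -[psq ^+ k]mulr1 psqXM; case: leqP => [le_kn|lt_nk]; last by rewrite ltn_eqF.
rewrite -[1]/psone /psone; case: ltngtP le_kn => // [lt_kn|->]; last by rewrite subnn.
by case E: (n - k)%N => [|//] _; move: E; lia.
Qed.

Definition eqmodq (N : nat) (f g : pser) := forall i, (i < N)%N -> f i = g i.

Lemma eqmodq_refl N f : eqmodq N f f. Proof. by []. Qed.
Lemma eqmodq_sym N f g : eqmodq N f g -> eqmodq N g f.
Proof. by move=> e i lt_iN; rewrite e. Qed.
Lemma eqmodq_trans N g f h : eqmodq N f g -> eqmodq N g h -> eqmodq N f h.
Proof. by move=> e1 e2 i lt_iN; rewrite e1 // e2. Qed.
Lemma eqmodq_le M N f g : (M <= N)%N -> eqmodq N f g -> eqmodq M f g.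
Proof. by move=> le_MN e i lt_iM; apply: e; apply: leq_trans le_MN. Qed.
Lemma eqmodqD N f g f' g' : eqmodq N f f' -> eqmodq N g g' -> eqmodq N (f + g) (f' + g').
Proof. by move=> e1 e2 i lt_iN; rewrite !psD e1 // e2. Qed.
Lemma eqmodqM N f g f' g' : eqmodq N f f' -> eqmodq N g g' -> eqmodq N (f * g) (f' * g').
Proof.
move=> e1 e2 i lt_iN; rewrite !psM; apply: eq_bigr => j _.
by rewrite e1 ?e2 // (leq_ltn_trans _ lt_iN) ?leq_subr ?leq_ord.
Qed.
Lemma eqmodq_sum N (I : Type) (r : seq I) (P : pred I) (F G : I -> pser) :
  (forall i, P i -> eqmodq N (F i) (G i)) ->
  eqmodq N (\sum_(i <- r | P i) F i) (\sum_(i <- r | P i) G i).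
Proof. by move=> e i lt_iN; rewrite !ps_sum; apply: eq_bigr => j /e ->. Qed.
Lemma eqmodq_prod N (I : Type) (r : seq I) (P : pred I) (F G : I -> pser) :
  (forall i, P i -> eqmodq N (F i) (G i)) ->
  eqmodq N (\prod_(i <- r | P i) F i) (\prod_(i <- r | P i) G i).
Proof.
by move=> e; apply: (big_ind2 (eqmodq N)) => // *; apply: eqmodqM.
Qed.
Lemma eqmodq_ext f g : (forall N, eqmodq N f g) -> f = g.
Proof. by move=> e; apply/funext=> n; apply: (e n.+1). Qed.
Lemma eqmodq_qX0 k f N : (N <= k)%N -> eqmodq N (psq ^+ k * f) 0.
Proof. by move=> le_Nk i lt_iN; rewrite psqXM leqNgt (leq_trans lt_iN). Qed.

(** Coefficient [N] is read off the factors 0 to [N]. Under [tends1] the later factors are 1 modulo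
    q^(N+1), so they cannot change it. *)
Definition iprod (F : nat -> pser) : pser := fun N => (\prod_(j < N.+1) F j) N.

Definition tends1 (F : nat -> pser) := forall j, eqmodq j (F j) 1.

Lemma prod_stable F N n : tends1 F -> (N <= n)%N ->
  eqmodq N (\prod_(j < n) F j) (\prod_(j < N) F j).
Proof.
move=> F1; elim: n => [|n IH]; first by rewrite leqn0 => /eqP ->.
rewrite leq_eqVlt => /orP[/eqP -> //|]; rewrite ltnS => le_Nn.
rewrite big_ord_recr /= -[X in eqmodq _ _ X]mulr1.
by apply: eqmodqM; [apply: IH | apply: eqmodq_le (F1 n)].
Qed.

Lemma iprod_eqmod F N n : tends1 F -> (N <= n)%N ->
  eqmodq N (iprod F) (\prod_(j < n) F j).
Proof.
move=> F1 le_Nn i lt_iN.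
by rewrite (prod_stable F1 (leq_trans lt_iN le_Nn)).
Qed.

(** The partial product may be longer than [N]: [iprod_split] compares with one of [N * k] factors,
    grouped by residue modulo [k]. *)
Lemma iprod_unique F g : tends1 F ->
  (forall N, exists2 n, (N <= n)%N & eqmodq N g (\prod_(j < n) F j)) -> g = iprod F.
Proof.
move=> F1 e; apply: eqmodq_ext => N; have [n le_Nn eg] := e N.
exact: eqmodq_trans eg (eqmodq_sym (iprod_eqmod F1 le_Nn)).
Qed.

Lemma eq_iprod F G : F =1 G -> iprod F = iprod G.
Proof. by move=> e; apply/funext=> N; rewrite /iprod; under eq_bigr do rewrite e. Qed.

Lemma tends1M F G : tends1 F -> tends1 G -> tends1 (fun j => F j * G j).
Proof. by move=> F1 G1 j; rewrite -[X in eqmodq _ _ X]mulr1; apply: eqmodqM. Qed.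

Lemma iprodM F G : tends1 F -> tends1 G ->
  iprod F * iprod G = iprod (fun j => F j * G j).
Proof.
move=> F1 G1; apply: iprod_unique (tends1M F1 G1) _ => N; exists N => //.
by rewrite big_split /=; apply: eqmodqM; apply: iprod_eqmod.
Qed.

Lemma tends1_sub F k r : (0 < k)%N -> tends1 F -> tends1 (fun j => F (k * j + r)%N).
Proof. by move=> k0 F1 j; apply: eqmodq_le (F1 _); nia. Qed.

Lemma iprod_split k F : (0 < k)%N -> tends1 F ->
  iprod F = \prod_(r < k) iprod (fun j => F (k * j + r)%N).
Proof.
move=> k0 F1; symmetry; apply: iprod_unique => // N; exists (N * k)%N; first by nia.
rewrite -(big_mkord xpredT) big_nat_mul big_mkord.
under [X in eqmodq _ _ X]eq_bigr => i _.
  rewrite -{1}[(i * k)%N]add0n big_addn mulSn addnK big_mkord.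
  under eq_bigr => j _ do rewrite addnC mulnC.
  over.
rewrite exchange_big; apply: eqmodq_prod => r _.
by apply: iprod_eqmod => //; apply: tends1_sub.
Qed.

Lemma iprodS F : tends1 F -> iprod F = F 0%N * iprod (fun j => F j.+1).
Proof.
move=> F1; symmetry; apply: iprod_unique => // N; exists N.+1 => //.
rewrite big_ord_recl; apply: eqmodqM => //; apply: iprod_eqmod => // j.
exact: eqmodq_le (F1 _).
Qed.

(** The q-Pochhammer symbol (-c q^a; q^M) with infinitely many factors; [pl] and [mi] are the cases
    of sign + and -. *)
Definition poch (c : pser) (a M : nat) := iprod (fun j => 1 + c * psq ^+ (a + j * M)).

Lemma poch_tends1 c a M : (0 < M)%N -> tends1 (fun j => 1 + c * psq ^+ (a + j * M)).
Proof.
move=> M0 j; rewrite -[X in eqmodq _ _ X]addr0 mulrC; apply: eqmodqD => //.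
by apply: eqmodq_qX0; nia.
Qed.


Local Notation pl := (poch 1).
Local Notation mi := (poch (-1)).

Lemma poch_plmi a M : (0 < M)%N -> pl a M * mi a M = mi (2 * a) (2 * M).
Proof.
move=> M0; rewrite iprodM; do ?exact: poch_tends1.
apply: eq_iprod => j; rewrite (_ : 2 * a + _ = (a + j * M) * 2)%N; last by nia.
by rewrite exprM; ring.
Qed.

Lemma poch_split k c a M : (0 < M)%N -> (0 < k)%N ->
  poch c a M = \prod_(r < k) poch c (a + r * M) (k * M).
Proof.
move=> M0 k0; rewrite /poch (iprod_split k0); last exact: poch_tends1.
apply: eq_bigr => r _; apply: eq_iprod => j.
by congr (1 + c * psq ^+ _); rewrite mulnDl -addnA; congr addn; rewrite addnC mulnCA mulnA.
Qed.

Lemma poch0 M : (0 < M)%N -> pl 0 M = 2 * pl M M.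
Proof.
move=> M0; rewrite /poch iprodS; last exact: (poch_tends1 1 0).
by rewrite mul0n expr0 mulr1 -natr1; congr (_ * _); apply: eq_iprod => j; rewrite add0n mulSn.
Qed.

Lemma fmE m : (0 < m)%N -> fm m = mi m m.
Proof.
move=> m0; apply/funext=> N; rewrite /fm /poch /iprod.
rewrite big_add1 /= big_mkord.
rewrite big_ord_recr /=.
(* [fm] uses [N] factors and [iprod] one more; the extra factor is 1 modulo q^(N+1). *)
have -> : (\prod_(j < N) (1 + -1 * psq ^+ (m + j * m)) *
    (1 + -1 * psq ^+ (m + N * m))) N = (\prod_(j < N) (1 + -1 * psq ^+ (m + j * m))) N.
  rewrite -[in RHS](mulr1 (\prod_(j < N) _)).
  apply: (@eqmodqM N.+1) (ltnSn N) => //; rewrite -[X in eqmodq _ _ X]addr0 mulrC.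
  by apply: eqmodqD => //; apply: eqmodq_qX0; nia.
pose P (p : {poly rat}) (f : pser) := forall i, p`_i = f i.
suff: P (\prod_(i < N) (1 - 'X^(m * i.+1)))
        (\prod_(j < N) (1 + -1 * psq ^+ (m + j * m))) by move=> e; apply: e.
apply: (big_ind2 P).
- by move=> [|i]; rewrite coef1.
- by move=> p f p' f' e e' i; rewrite coefM psM; apply: eq_bigr => j _; rewrite e e'.
move=> j _ i; rewrite coefB coef1 coefXn mulN1r psB psqX mulnC mulSn.
by case: i.
Qed.

(** * The substitutions q -> -q and q -> q^2 *)

Definition twist (f : pser) : pser := fun n => (-1) ^+ n * f n.

Lemma twist_is_zmod_morphism : zmod_morphism twist.
Proof. by move=> f g; apply/funext=> n; rewrite /twist !psB mulrBr. Qed.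
Lemma twist_is_monoid_morphism : monoid_morphism twist.
Proof.
split=> [|f g]; apply/funext=> n; first by case: n => [|n]; rewrite /twist /= ?mul1r ?mulr0.
rewrite /twist !psM mulr_sumr; apply: eq_bigr => i _.
by rewrite mulrACA -exprD subnKC ?leq_ord.
Qed.
HB.instance Definition _ :=
  GRing.isZmodMorphism.Build pser pser twist twist_is_zmod_morphism.
HB.instance Definition _ :=
  GRing.isMonoidMorphism.Build pser pser twist twist_is_monoid_morphism.

Definition dilate2 (f : pser) : pser := fun n => if odd n then 0 else f n./2.

Lemma sum_odd_even (R : nmodType) (F : nat -> R) n :
  \sum_(i < n.*2.+1) F i = \sum_(i < n.+1) F i.*2 + \sum_(i < n) F i.*2.+1.
Proof.
elim: n => [|n IH]; first by rewrite !big_ord1 big_ord0 addr0.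
rewrite doubleS 2!big_ord_recr IH /=.
rewrite [X in _ = X + _]big_ord_recr [X in _ = _ + X]big_ord_recr /= doubleS.
by rewrite -[LHS]addrA (addrC (F _)) addrACA.
Qed.

Lemma dilate2_is_zmod_morphism : zmod_morphism dilate2.
Proof. by move=> f g; apply/funext=> n; rewrite /dilate2 !psB; case: odd; rewrite ?subr0. Qed.
Lemma dilate2_is_monoid_morphism : monoid_morphism dilate2.
Proof.
split=> [|f g]; apply/funext=> n; first by case: n => [|[|n]] //; rewrite /dilate2; case: odd.
have [on|en] := boolP (odd n); rewrite psM {1}/dilate2 ?on ?(negbTE en).
  rewrite big1 // => i _; rewrite /dilate2 oddB ?leq_ord // on.
  by case: odd; rewrite ?mul0r ?mulr0.
rewrite -(even_halfK en); move: n./2 => m {n en}; rewrite doubleK.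
rewrite (sum_odd_even (fun i => dilate2 f i * dilate2 g (m.*2 - i)%N)) psM.
rewrite [X in _ = _ + X]big1 ?addr0; last first.
  by move=> i _; rewrite /dilate2 /= odd_double mul0r.
by apply: eq_bigr => i _; rewrite /dilate2 -doubleB !odd_double !doubleK.
Qed.
HB.instance Definition _ :=
  GRing.isZmodMorphism.Build pser pser dilate2 dilate2_is_zmod_morphism.
HB.instance Definition _ :=
  GRing.isMonoidMorphism.Build pser pser dilate2 dilate2_is_monoid_morphism.

Lemma dilate2_double f n : dilate2 f n.*2 = f n.
Proof. by rewrite /dilate2 odd_double doubleK. Qed.

(** The second hypothesis is q-adic continuity, which lets a ring morphism pass through an infinite
    product. *)
Lemma morph_iprod (phi : {rmorphism pser -> pser}) F : tends1 F ->
  (forall N f g, eqmodq N f g -> eqmodq N (phi f) (phi g)) ->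
  phi (iprod F) = iprod (fun j => phi (F j)).
Proof.
move=> F1 cphi; apply: iprod_unique => [j|N].
  by rewrite -(rmorph1 phi); apply: cphi.
by exists N => //; rewrite -rmorph_prod; apply: cphi; apply: iprod_eqmod.
Qed.

Lemma twist_eqmodq N f g : eqmodq N f g -> eqmodq N (twist f) (twist g).
Proof. by move=> e i lt_iN; rewrite /twist e. Qed.
Lemma dilate2_eqmodq N f g : eqmodq N f g -> eqmodq N (dilate2 f) (dilate2 g).
Proof. by move=> e i lt_iN; rewrite /dilate2; case: odd => //; apply: e; lia. Qed.

Lemma twist_psq : twist psq = - psq.
Proof. by apply/funext=> -[|[|n]]; rewrite /twist psN /psq /= ?mulr0 ?mulr1 ?oppr0. Qed.
Lemma dilate2_psq : dilate2 psq = psq ^+ 2.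
Proof.
apply/funext=> n; rewrite psqX /dilate2 /psq.
by case: n => [|[|[|[|n]]]] //; rewrite /= ?negbK; case: odd.
Qed.

Lemma twist_poch (c : int) a M : (0 < M)%N -> ~~ odd M ->
  twist (poch c%:~R a M) = poch (c%:~R * (-1) ^+ a) a M.
Proof.
move=> M0 eM; rewrite (morph_iprod (poch_tends1 _ _ M0) twist_eqmodq).
apply: eq_iprod => j; rewrite rmorphD rmorphM rmorphXn rmorph1 rmorph_int /= twist_psq.
rewrite (exprNn psq) mulrA -(signr_odd _ (a + _)) oddD oddM (negbTE eM) andbF addbF.
by rewrite signr_odd.
Qed.

Lemma dilate2_poch (c : int) a M : (0 < M)%N ->
  dilate2 (poch c%:~R a M) = poch c%:~R (2 * a) (2 * M).
Proof.
move=> M0; rewrite (morph_iprod (poch_tends1 _ _ M0) dilate2_eqmodq).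
apply: eq_iprod => j; rewrite rmorphD rmorphM rmorphXn rmorph1 rmorph_int /= dilate2_psq.
by rewrite -exprM mulnDr mulnCA.
Qed.

Lemma dilate2_fm m : (0 < m)%N -> dilate2 (fm m) = fm (2 * m).
Proof. by move=> m0; rewrite !fmE ?muln_gt0 // (dilate2_poch (-1)). Qed.

Lemma twist_fm_even m : (0 < m)%N -> ~~ odd m -> twist (fm m) = fm m.
Proof.
move=> m0 em; rewrite !fmE // (twist_poch (-1)) //.
by rewrite -[(-1) ^+ m]signr_odd (negbTE em) mulr1.
Qed.

Lemma poch_split2 c a M : (0 < M)%N -> poch c a M = poch c a (2 * M) * poch c (a + M) (2 * M).
Proof.
move=> M0; rewrite (@poch_split 2) // !big_ord_recr big_ord0 /= mul1r.
by rewrite mul0n addn0 mul1n.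
Qed.

Lemma pl_fm m : (0 < m)%N -> pl m m * fm m = fm (2 * m).
Proof. by move=> m0; rewrite !fmE ?muln_gt0 // poch_plmi. Qed.

(** The product of 1 + q^j over all multiples j of m is f_2m / f_m, and over the even multiples f_4m
    / f_2m; the odd multiples give the quotient. *)
Lemma pl_odd_fm m : (0 < m)%N -> pl m (2 * m) * (fm m * fm (4 * m)) = fm (2 * m) ^+ 2.
Proof.
move=> m0; have m20 : (0 < 2 * m)%N by rewrite muln_gt0.
have e1 := pl_fm m0; have e2 := pl_fm m20.
rewrite poch_split2 // addnn -mul2n in e1.
rewrite -[4%N]/(2 * 2)%N -mulnA -e2.
transitivity (pl m (2 * m) * pl (2 * m) (2 * m) * fm m * fm (2 * m)); first by ring.
by rewrite e1.
Qed.

(** As m is odd, q -> -q flips the sign in the factors of f_m at odd multiples of m, which become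
    [pl m (2 * m)], and fixes the others, which form f_2m. *)
Lemma twist_fm_odd m : odd m -> twist (fm m) * (fm m * fm (4 * m)) = fm (2 * m) ^+ 3.
Proof.
move=> om; have m0 : (0 < m)%N by case: m om.
have m20 : (0 < 2 * m)%N by rewrite muln_gt0.
have -> : twist (fm m) = pl m (2 * m) * fm (2 * m).
  rewrite fmE // poch_split2 // addnn -mul2n -fmE // rmorphM /= twist_fm_even //; last first.
    by rewrite oddM.
  rewrite (twist_poch (-1)) ?oddM // -signr_odd om expr1 /=.
  by congr (poch _ _ _ * _); ring.
by rewrite mulrAC pl_odd_fm // exprS mulrC.
Qed.

(** * Jacobi's triple product *)

Section QBinomial.
Variables (R : comNzRingType) (Q : R).

(** The Gaussian binomial coefficient, given by its Pascal rule because [R] need not have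
    division. *)
Fixpoint qbin (m j : nat) : R :=
  match m, j with
  | _, 0%N => 1
  | 0%N, _.+1 => 0
  | m'.+1, j'.+1 => qbin m' j' + Q ^+ j * qbin m' j
  end.

Definition qfact (n : nat) : R := \prod_(i < n) (1 - Q ^+ i.+1).

Lemma qbin0 m : qbin m 0 = 1. Proof. by case: m. Qed.

Lemma qbin_small m j : (m < j)%N -> qbin m j = 0.
Proof. by elim: m j => [|m IH] [|j] //= lt_mj; rewrite !IH ?mulr0 ?addr0 // ltnW. Qed.

Lemma qbin_fact m j : (j <= m)%N -> qbin m j * qfact j * qfact (m - j) = qfact m.
Proof.
elim: m j => [|m IH] [|j] //.
- by move=> _; rewrite /qfact big_ord0 !mulr1.
- by move=> _; rewrite /= /qfact big_ord0 !mul1r.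
rewrite ltnS subSS /= => le_jm.
have factS n : qfact n.+1 = qfact n * (1 - Q ^+ n.+1) by rewrite /qfact big_ord_recr.
transitivity (qfact m * (1 - Q ^+ j.+1) +
    Q ^+ j.+1 * (qbin m j.+1 * qfact j.+1 * qfact (m - j))).
  by rewrite -(IH _ le_jm) factS; ring.
rewrite [RHS]factS; have [lt_jm|le_mj] := ltnP j m; last first.
  have <- : j = m by apply/eqP; rewrite eqn_leq le_jm.
  by rewrite qbin_small //; ring.
rewrite -(subnSK lt_jm) [qfact (m - j.+1).+1]factS (subnSK lt_jm).
rewrite [X in _ + _ * X]mulrA IH //.
have -> : Q ^+ m.+1 = Q ^+ j.+1 * Q ^+ (m - j) by rewrite -exprD; congr (Q ^+ _); lia.
by ring.
Qed.

(** Induction peels off the factor at 0, which replaces [z] by [z * Q] in the others; the Pascal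
    rule recombines the two sums. *)
Lemma qbinomial (y z : R) m :
  \prod_(j < m) (y + z * Q ^+ j) =
  \sum_(j < m.+1) qbin m j * Q ^+ 'C(j, 2) * z ^+ j * y ^+ (m - j).
Proof.
elim: m z => [|m IH] z; first by rewrite big_ord0 big_ord1 !mulr1.
rewrite big_ord_recl /= expr0 mulr1.
under eq_bigr => j _ do rewrite exprS mulrA.
rewrite IH mulrDl; set S := \sum_(_ < _) _.
have -> : y * S = \sum_(j < m.+2) qbin m j * Q ^+ (j + 'C(j, 2)) * z ^+ j * y ^+ (m.+1 - j).
  rewrite [RHS]big_ord_recr /= (qbin_small (ltnSn m)) !mul0r addr0 mulr_sumr.
  by apply: eq_bigr => i _; rewrite subSn ?leq_ord // exprMn !exprS exprD; ring.
have -> : z * S = \sum_(j < m.+1) qbin m j * Q ^+ 'C(j.+1, 2) * z ^+ j.+1 * y ^+ (m - j).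
  rewrite mulr_sumr; apply: eq_bigr => i _.
  by rewrite exprMn exprS binS bin1 exprD; ring.
rewrite big_ord_recl [RHS]big_ord_recl /= !qbin0 -addrA; congr (_ + _).
rewrite -big_split /=; apply: eq_bigr => i _.
rewrite /bump /= add1n subSS exprD; ring.
Qed.

End QBinomial.

(** The triangular number k(k+1)/2 for any integer k. It is invariant under k -> -1-k, so both
    constructors share one formula. *)
Definition tri (k : int) : nat := match k with Posz n | Negz n => 'C(n.+1, 2) end.

Lemma bin2E n : ('C(n, 2))%:Z * 2 = n%:Z * (n%:Z - 1).
Proof.
elim: n => [|n IH]; first by rewrite mul0r.
by rewrite binS bin1 PoszD mulrDl IH intS; ring.
Qed.

Lemma triE k : (tri k)%:Z * 2 = k * (k + 1).
Proof. by case: k => n; rewrite /tri bin2E ?NegzE intS; ring. Qed.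

(** The exponents in Ramanujan's theta function f(q^a, q^b). *)
Definition texp (a b : nat) (k : int) : nat := (a * tri k + b * tri (- k))%N.

Lemma texpE a b k : (texp a b k)%:Z * 2 = a%:Z * (k * (k + 1)) + b%:Z * (k * (k - 1)).
Proof.
rewrite /texp PoszD !PoszM mulrDl -!mulrA !triE; ring.
Qed.

(* The q-binomial theorem at [Q = q^M], [y = q^(nM + b)], [z = 1]: the first half of the
   factors gives the powers [q^(b + iM)], the second half the powers [q^(a + iM)]. *)
Lemma finite_jtp a b n : let M := (a + b)%N in
  (\prod_(i < n.+1) (1 + psq ^+ (a + i * M))) *
  (\prod_(i < n.+1) (1 + psq ^+ (b + i * M))) =
  \sum_(j < (n.+1 + n.+1).+1) qbin (psq ^+ M) (n.+1 + n.+1) j *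
     psq ^+ texp a b (j%:Z - n.+1%:Z).
Proof.
move=> M; set y := psq ^+ (n * M + b); set Q := psq ^+ M.
(* [E] is the total power of q extracted from the factors y + Q^j: Q^j from each of the first
   [n.+1], and y from each of the others. *)
set E := (M * 'C(n.+1, 2) + (n * M + b) * n.+1)%N.
have psq0 : psq != 0 by apply/eqP => /(congr1 (fun f : pser => f 1%N))/eqP; rewrite oner_eq0.
apply: (mulfI (expf_neq0 E psq0)).
transitivity (\prod_(j < n.+1 + n.+1) (y + 1 * Q ^+ j)).
  rewrite big_split_ord /= [X in psq ^+ E * X]mulrC [psq ^+ E]exprD mulrACA; congr (_ * _).
    transitivity (\prod_(i < n.+1) (psq ^+ (M * i) * (1 + psq ^+ (b + (n - i) * M)))).
      rewrite big_split /= -expr_sum -big_distrr /=.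
      rewrite -(big_mkord xpredT id) bin2_sum; congr (_ * _).
      rewrite (reindex_inj rev_ord_inj) /=; apply: eq_bigr => i _.
      by rewrite subSS.
    apply: eq_bigr => i _; rewrite mul1r -exprM mulrDr mulr1 addrC -exprD.
    by congr (psq ^+ _ + _); have := ltn_ord i; nia.
  rewrite exprM -/y.
  have -> : y ^+ n.+1 = \prod_(i < n.+1) y by rewrite prodr_const card_ord.
  rewrite -big_split /=.
  apply: eq_bigr => i _; rewrite mul1r -exprM mulrDr mulr1 -exprD.
  by congr (_ + psq ^+ _); rewrite /M; nia.
rewrite qbinomial mulr_sumr; apply: eq_bigr => j _.
rewrite expr1n mulr1 -exprM -exprM mulrCA -mulrA -!exprD; congr (_ * _ ^+ _).
apply/eqP; rewrite -eqz_nat; apply/eqP.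
have n2 : (2 : int) != 0 by [].
apply: (mulIf n2).
rewrite /E /texp !PoszD !PoszM -subzn; last by rewrite -ltnS.
rewrite !mulrDl -!mulrA !triE !bin2E /M !PoszD !PoszM !intS.
ring.
Qed.

(** The series of q^(e i) over [P]. The sum is 0 by default on infinite support, so the series is
    the intended one when [e] takes each value finitely often on [P]. *)
Definition gsum (I : choiceType) (P : pred I) (e : I -> nat) : pser :=
  fun n => \sum_(i \in [set` P]) ((e i == n)%:R : rat).

Lemma gsumE (I : choiceType) (P : pred I) (e : I -> nat) n (r : seq I) :
  uniq r -> (forall i, P i -> e i = n -> i \in r) ->
  gsum P e n = \sum_(i <- r | P i) ((e i == n)%:R : rat).
Proof.
move=> ur er; rewrite (bigfs _ ur) // => i Pi; apply: contraNeq => /eqP ne0.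
by apply: er => //; apply/eqP; apply: contra_notT ne0 => /negbTE ->.
Qed.

Definition ibox (N : nat) : seq int := [seq j%:Z - N%:Z | j <- index_iota 0 (N + N).+1].

Lemma ibox_uniq N : uniq (ibox N).
Proof. by rewrite map_inj_uniq ?iota_uniq // => i j /(addIr _) []. Qed.

Lemma mem_ibox N k : (`|k| <= N)%N -> k \in ibox N.
Proof.
move=> le_kN; apply/mapP; exists (absz (k + N%:Z)%R); first by rewrite mem_index_iota; lia.
by rewrite gez0_abs; lia.
Qed.

Lemma texp_ge a b k : (0 < a + b)%N -> (`|k| <= (texp a b k).+1)%N.
Proof.
move=> ab0; have e1 := triE k; have e2 := triE (- k).
have : (`|k| <= (tri k).+1 /\ `|k| <= (tri (- k)).+1)%N by split; nia.
by rewrite /texp => -[l1 l2]; case: a b ab0 => [|a] [|b] //= _; nia.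
Qed.

(** Modulo q^N the three q-factorials in [qbin_fact] all equal the infinite product [P], a unit that
    can be cancelled. *)
Lemma eqmodq_qbin M N m j : (0 < M)%N -> (N <= j)%N -> (j + N <= m)%N ->
  eqmodq N (mi M M * qbin (psq ^+ M) m j) 1.
Proof.
move=> M0 le_Nj le_jm; set P := mi M M.
have eP n : (N <= n)%N -> eqmodq N P (qfact (psq ^+ M) n).
  move=> le_Nn; have := iprod_eqmod (poch_tends1 (-1) M M0) le_Nn.
  congr eqmodq; apply: eq_bigr => i _.
  by rewrite -exprM mulnS mulN1r mulnC.
have uP : P \is a GRing.unit.
  rewrite /P -fmE // unfold_in /= /psunit /fm big_geq // coef1.
  exact: oner_neq0.
have e : eqmodq N (P * qbin (psq ^+ M) m j * (P * P)) (P * P).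
  have le_jm' : (j <= m)%N by lia.
  rewrite mulrA -[X in eqmodq N _ (P * X)]mulr1.
  apply: (@eqmodq_trans _ (P * qfact (psq ^+ M) m)); last first.
    rewrite mulr1; apply: eqmodqM => //; apply: eqmodq_sym; apply: eP; lia.
  rewrite -(qbin_fact (psq ^+ M) le_jm') mulrA [P * (_ * _)]mulrA.
  by do 2!(apply: eqmodqM; last by apply: eP; lia).
have := eqmodqM e (@eqmodq_refl N (P * P)^-1).
by rewrite mulrK ?unitrM ?uP // divrr ?unitrM ?uP.
Qed.

Theorem jacobi_triple a b : (0 < a + b)%N ->
  gsum predT (texp a b) = pl a (a + b) * pl b (a + b) * mi (a + b) (a + b).
Proof.
(* With n = 2N, a term of exponent below N has j and 2(n+1) - j both at least N, so its Gaussian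
   binomial times [mi M M] is 1 modulo q^N. The other terms vanish modulo q^N. *)
set M := (a + b)%N => M0; apply: eqmodq_ext => N; pose n := (N + N)%N.
have le_Nn : (N <= n.+1)%N by lia.
apply: (@eqmodq_trans _ (\sum_(j < (n.+1 + n.+1).+1) psq ^+ texp a b (j%:Z - n.+1%:Z))).
  move=> i lt_iN; rewrite (@gsumE _ _ _ _ (ibox n.+1)) ?ibox_uniq //; last first.
    by move=> k _ ek; apply: mem_ibox; have := texp_ge k M0; rewrite ek; lia.
  rewrite big_map big_mkord ps_sum.
  by apply: eq_bigr => j _; rewrite psqX eq_sym.
apply: eqmodq_sym; rewrite mulrC.
have e1 := iprod_eqmod (poch_tends1 1 a M0) le_Nn.
have e2 := iprod_eqmod (poch_tends1 1 b M0) le_Nn.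
apply: (eqmodq_trans (eqmodqM (@eqmodq_refl N (mi M M)) (eqmodqM e1 e2))).
rewrite [X in mi M M * X](_ : _ = \sum_(j < (n.+1 + n.+1).+1)
   qbin (psq ^+ M) (n.+1 + n.+1) j * psq ^+ texp a b (j%:Z - n.+1%:Z)); last first.
  by rewrite -finite_jtp; congr (_ * _); apply: eq_bigr => j _; rewrite mul1r.
rewrite mulr_sumr; apply: eqmodq_sum => j _; set t := texp a b _.
rewrite mulrA.
have [le_Nt|lt_tN] := leqP N t.
  rewrite mulrC -[X in eqmodq _ _ X]mulr1.
  apply: (@eqmodq_trans _ 0); first exact: eqmodq_qX0.
  by apply: eqmodq_sym; apply: eqmodq_qX0.
rewrite -[X in eqmodq _ _ X]mul1r; apply: eqmodqM => //.
have := texp_ge (j%:Z - n.+1%:Z) M0; rewrite -/t => le_jt; have lt_j := ltn_ord j.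
by apply: eqmodq_qbin => //; lia.
Qed.

Lemma gsumM (I J : choiceType) (e : I -> nat) (e' : J -> nat) :
  (forall n, exists r : seq I, forall i, (e i <= n)%N -> i \in r) ->
  (forall n, exists r : seq J, forall i, (e' i <= n)%N -> i \in r) ->
  gsum predT e * gsum predT e' = gsum predT (fun p : I * J => (e p.1 + e' p.2)%N).
Proof.
move=> fe fe'; apply/funext => n; rewrite psM.
have [r hr] := fe n; have [r' hr'] := fe' n.
pose u := undup r; pose u' := undup r'.
rewrite (@gsumE _ _ _ _ [seq (i, j) | i <- u, j <- u']); first last.
- case=> i j _ /= eij; apply/allpairsP; exists (i, j).
  split=> /=; rewrite ?mem_undup; [apply: hr; lia | apply: hr'; lia | by []].
- by apply: allpairs_uniq; rewrite ?undup_uniq // => -[? ?] [? ?].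
rewrite big_allpairs /=.
under eq_bigr => k _.
  rewrite (@gsumE _ _ _ _ u) ?undup_uniq //; last first.
    by move=> i _ ei; rewrite mem_undup hr // ei leq_ord.
  rewrite (@gsumE _ _ _ _ u') ?undup_uniq //; last first.
    by move=> i _ ei; rewrite mem_undup hr' // ei leq_subr.
  rewrite mulr_suml.
  under eq_bigr do rewrite mulr_sumr.
  over.
rewrite exchange_big; apply: eq_bigr => i _.
rewrite exchange_big; apply: eq_bigr => j _ /=.
have [le_n|lt_n] := leqP (e i) n; last first.
  rewrite big1 => [|k _]; first by rewrite (_ : _ == n = false) //; lia.
  by rewrite (_ : e i == k = false) ?mul0r //; have := ltn_ord k; lia.
rewrite (bigD1 (Ordinal (le_n : (e i < n.+1)%N))) //= eqxx mul1r big1 ?addr0.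
  by congr _%:R; lia.
move=> k; rewrite -val_eqE /= => ne; rewrite (_ : e i == k = false) ?mul0r //.
by apply/negbTE; rewrite eq_sym.
Qed.

(** * Two theta identities of level 5 from the Gaussian integers *)

Definition finite_fibers (I : choiceType) (e : I -> nat) :=
  forall n, exists r : seq I, forall i, (e i <= n)%N -> i \in r.

Lemma gsumID (I : choiceType) (P Q : pred I) (e : I -> nat) : finite_fibers e ->
  gsum P e = gsum (predI P Q) e + gsum (predD P Q) e.
Proof.
move=> fe; apply/funext => n; have [r hr] := fe n; rewrite psD.
have mem_r i : e i = n -> i \in undup r by move=> ei; rewrite mem_undup hr ?ei.
rewrite !(@gsumE _ _ _ _ (undup r)) ?undup_uniq // => [|i _ /mem_r|i _ /mem_r|i _ /mem_r] //.
by rewrite (bigID Q) /=; congr (_ + _); apply: eq_bigl => i; rewrite /= andbC.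
Qed.

Lemma gsum_reindex (I J : choiceType) (h : J -> I) (g : I -> J) (P : pred I) (Q : pred J)
    (e : I -> nat) :
  (forall j, Q j -> P (h j)) -> (forall i, P i -> Q (g i)) ->
  (forall j, Q j -> g (h j) = j) -> (forall i, P i -> h (g i) = i) ->
  gsum P e = gsum Q (e \o h).
Proof.
move=> QP PQ hK gK; apply/funext => n; rewrite /gsum.
apply: (@reindex_fsbig _ _ _ _ _ h [set` Q] [set` P]); split.
- by move=> j /= Qj; apply: QP.
- by move=> i j /set_mem/= Qi /set_mem/= Qj eh; rewrite -(hK i Qi) eh hK.
- by move=> i /= Pi; exists (g i); [apply: PQ | apply: gK].
Qed.

Lemma eq_gsuml (I : choiceType) (P Q : pred I) (e : I -> nat) :
  P =1 Q -> gsum P e = gsum Q e.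
Proof. by move=> /funext ->. Qed.

Lemma eq_gsumr (I : choiceType) (P : pred I) (e e' : I -> nat) :
  e =1 e' -> gsum P e = gsum P e'.
Proof. by move=> /funext ->. Qed.

Lemma gsum_shift (I : choiceType) (P : pred I) (e : I -> nat) :
  gsum P (fun i => (e i).+1) = psq * gsum P e.
Proof.
apply/funext => -[|n]; rewrite psqM /gsum //.
exact: fsbig1.
Qed.

(** [c] plays the class modulo [2 + i] and [rho] the multiplication by [i], so that
    [rho] multiplies [c] by [i = 3 mod 5]; [h0] and [h1] parametrize the classes 0 and 1. *)
Lemma rotation_split (T : choiceType) (E : T -> nat) (c : T -> int)
    (rho rho' h0 g0 h1 g1 : T -> T) :
  finite_fibers E -> cancel rho rho' -> cancel rho' rho ->
  (forall w, E (rho w) = E w) ->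
  (forall w, (c (rho w) %% 5)%Z = (3 * c w %% 5)%Z) ->
  (forall w, (c (h0 w) %% 5)%Z = 0) -> cancel h0 g0 ->
  (forall w, (c w %% 5)%Z = 0 -> h0 (g0 w) = w) ->
  (forall w, (c (h1 w) %% 5)%Z = 1) -> cancel h1 g1 ->
  (forall w, (c w %% 5)%Z = 1 -> h1 (g1 w) = w) ->
  gsum predT E = gsum predT (E \o h0) + 4 * gsum predT (E \o h1).
Proof.
move=> fE rK r'K Er cr c0 h0K g0K c1 h1K g1K.
pose G k := gsum (fun w => (c w %% 5)%Z == k) E.
have Grot k k' : (3 * k %% 5)%Z = k' -> (0 <= k < 5) -> G k' = G k.
  move=> ek k5; rewrite /G (@gsum_reindex _ _ rho rho' _ (fun w => (c w %% 5)%Z == k)) //.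
  - by apply: eq_gsumr.
  - by move=> w /eqP ew; rewrite cr; lia.
  - by move=> w /eqP; rewrite -{1}(r'K w) cr; lia.
have e0 : G 0 = gsum predT (E \o h0).
  apply: (@gsum_reindex _ _ h0 g0) => // w; [by rewrite c0 | by move/eqP/g0K].
have e1 : G 1 = gsum predT (E \o h1).
  apply: (@gsum_reindex _ _ h1 g1) => // w; [by rewrite c1 | by move/eqP/g1K].
(* The powers of 3 modulo 5 run through 1, 3, 4, 2, so the rotation links all nonzero classes. *)
have G3 : G 3 = G 1 by apply: Grot.
have G4 : G 4 = G 3 by apply: Grot.
have G2 : G 2 = G 4 by apply: Grot.
transitivity (G 0 + G 1 + G 2 + G 3 + G 4); last first.
  by rewrite G2 G4 G3 e0 e1; ring.
rewrite (gsumID _ (fun w => (c w %% 5)%Z == 0)) // -!addrA; congr (_ + _).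
rewrite (gsumID _ (fun w => (c w %% 5)%Z == 1)) //; congr (_ + _).
  by apply: eq_gsuml => w /=; lia.
rewrite (gsumID _ (fun w => (c w %% 5)%Z == 2)) //; congr (_ + _).
  by apply: eq_gsuml => w /=; lia.
rewrite (gsumID _ (fun w => (c w %% 5)%Z == 3)) //; congr (_ + _).
  by apply: eq_gsuml => w /=; lia.
by apply: eq_gsuml => w /=; lia.
Qed.

Lemma texp_finite a b : (0 < a + b)%N -> finite_fibers (texp a b).
Proof.
move=> ab0 n; exists (ibox n.+1) => k ek; apply: mem_ibox.
by have := texp_ge k ab0; lia.
Qed.

Lemma prod_finite_fibers (I J : choiceType) (e : I -> nat) (e' : J -> nat) :
  finite_fibers e -> finite_fibers e' ->
  finite_fibers (fun p : I * J => (e p.1 + e' p.2)%N).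
Proof.
move=> fe fe' n; have [r hr] := fe n; have [r' hr'] := fe' n.
exists [seq (i, j) | i <- r, j <- r'] => -[i j] /= le_n.
by apply/allpairsP; exists (i, j); split=> //=; [apply: hr | apply: hr']; lia.
Qed.

Definition theta a b := gsum predT (texp a b).

Lemma thetaM a b a' b' : (0 < a + b)%N -> (0 < a' + b')%N ->
  theta a b * theta a' b' =
  gsum predT (fun p : int * int => (texp a b p.1 + texp a' b' p.2)%N).
Proof. by move=> ab0 ab0'; apply: gsumM; apply: texp_finite. Qed.

(** [theta 1 1] is phi(q), so w is the Gaussian integer w.1 + i w.2. The maps [h0] and [h1] are (2 +
    i)w and (2 + i)w + 1; the norm of the latter separates into [texp 9 1], [texp 3 7] and the
    constant 1. *)
Lemma phi_theta :
  theta 1 1 ^+ 2 = theta 5 5 ^+ 2 + 4 * (psq * (theta 9 1 * theta 3 7)).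
Proof.
rewrite !expr2 !thetaM // -gsum_shift.
rewrite (@rotation_split _ _ (fun w => w.1 - 2 * w.2)
  (fun w => (- w.2, w.1)) (fun w => (w.2, - w.1))
  (fun w => (2 * w.1 - w.2, w.1 + 2 * w.2))
  (fun w => (((2 * w.1 + w.2) %/ 5)%Z, ((2 * w.2 - w.1) %/ 5)%Z))
  (fun w => (2 * w.1 - w.2 + 1, w.1 + 2 * w.2))
  (fun w => (((2 * w.1 + w.2 - 2) %/ 5)%Z, ((2 * w.2 - w.1 + 1) %/ 5)%Z))).
- congr (_ + 4 * _); apply: eq_gsumr => -[u v] /=.
  + have := texpE 1 1 (2 * u - v); have := texpE 1 1 (u + 2 * v).
    have := texpE 5 5 u; have := texpE 5 5 v; nia.
  + have := texpE 1 1 (2 * u - v + 1); have := texpE 1 1 (u + 2 * v).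
    have := texpE 9 1 u; have := texpE 3 7 v; nia.
- by apply: prod_finite_fibers; apply: texp_finite.
- by move=> [u v] /=; congr pair; lia.
- by move=> [u v] /=; congr pair; lia.
- move=> [u v] /=; have := texpE 1 1 (- v); have := texpE 1 1 v; nia.
- by move=> [u v] /=; lia.
- by move=> [u v] /=; lia.
- by move=> [u v] /=; congr pair; lia.
- by move=> [u v] /= ?; congr pair; lia.
- by move=> [u v] /=; lia.
- by move=> [u v] /=; congr pair; lia.
- by move=> [u v] /= ?; congr pair; lia.
Qed.

(** [theta 1 0] is 2 psi(q), and w stands for (w.1 + 1/2) + i (w.2 + 1/2), whence the shifts in the
    rotation. The class is again x - 2y of the shifted point, with -1/2 read as 2 modulo 5; [h0] is
    multiplication by 2 + i, and [h1] subtracts 1 + i from it. *)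
Lemma psi_theta :
  theta 1 0 ^+ 2 = psq * theta 5 0 ^+ 2 + 4 * (theta 2 3 * theta 4 1).
Proof.
rewrite !expr2 !thetaM // -gsum_shift.
rewrite (@rotation_split _ _ (fun w => w.1 - 2 * w.2 + 2)
  (fun w => (- w.2 - 1, w.1)) (fun w => (w.2, - w.1 - 1))
  (fun w => (2 * w.1 - w.2, w.1 + 2 * w.2 + 1))
  (fun w => (((2 * w.1 + w.2 - 1) %/ 5)%Z, ((2 * w.2 - 2 - w.1) %/ 5)%Z))
  (fun w => (2 * w.1 - w.2 - 1, w.1 + 2 * w.2))
  (fun w => (((2 * w.1 + w.2 + 2) %/ 5)%Z, ((2 * w.2 - w.1 - 1) %/ 5)%Z))).
- congr (_ + 4 * _); apply: eq_gsumr => -[u v] /=.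
  + have := texpE 1 0 (2 * u - v); have := texpE 1 0 (u + 2 * v + 1).
    have := texpE 5 0 u; have := texpE 5 0 v; nia.
  + have := texpE 1 0 (2 * u - v - 1); have := texpE 1 0 (u + 2 * v).
    have := texpE 2 3 u; have := texpE 4 1 v; nia.
- by apply: prod_finite_fibers; apply: texp_finite.
- by move=> [u v] /=; congr pair; lia.
- by move=> [u v] /=; congr pair; lia.
- move=> [u v] /=; have := texpE 1 0 (- v - 1); have := texpE 1 0 v; nia.
- by move=> [u v] /=; lia.
- by move=> [u v] /=; lia.
- by move=> [u v] /=; congr pair; lia.
- by move=> [u v] /= ?; congr pair; lia.
- by move=> [u v] /=; lia.
- by move=> [u v] /=; congr pair; lia.
- by move=> [u v] /= ?; congr pair; lia.
Qed.

(** * Algebra of the level 20 eta quotients *)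

Section Level20.
Variables (K : fieldType) (q f1 f2 f4 f5 f10 f20 : K).
Hypotheses (f1_neq0 : f1 != 0) (f2_neq0 : f2 != 0) (f4_neq0 : f4 != 0).
Hypotheses (f5_neq0 : f5 != 0) (f10_neq0 : f10 != 0) (f20_neq0 : f20 != 0).

Local Ltac field_nz :=
  field; rewrite ?f1_neq0 ?f2_neq0 ?f4_neq0 ?f5_neq0 ?f10_neq0 ?f20_neq0 //.

(* [hx] is a Hauptmodul of level 10; [hs] and [hy] are of level 20, and quadratic over it. *)
Definition hx := q * f1 * f10 ^+ 5 / (f2 * f5 ^+ 5).
Definition hs := f10 ^+ 15 * f1 ^+ 2 * f4 / (f5 ^+ 10 * f20 ^+ 5 * f2 ^+ 3).
Definition hy := f4 ^+ 2 * f10 ^+ 5 / (f20 ^+ 2 * f2 * f5 ^+ 3 * f1).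

Hypothesis psi_rel :
  f2 ^+ 4 / f1 ^+ 2 - q * (f10 ^+ 4 / f5 ^+ 2) = f2 * f5 ^+ 3 / (f1 * f10).
Hypothesis psi_rel_tw :
  f1 ^+ 2 * f4 ^+ 2 / f2 ^+ 2 + q * (f5 ^+ 2 * f20 ^+ 2 / f10 ^+ 2) =
  f10 ^+ 8 * f1 * f4 / (f5 ^+ 3 * f20 ^+ 3 * f2 ^+ 2).
Hypothesis phi_rel :
  f2 ^+ 10 / (f1 * f4) ^+ 4 - f10 ^+ 10 / (f5 * f20) ^+ 4 =
  4 * q * (f2 ^+ 2 * f5 * f20 / (f1 * f4)).
Hypothesis phi_rel_tw :
  f1 ^+ 4 / f2 ^+ 2 - f5 ^+ 4 / f10 ^+ 2 =
  - (4 * q * (f1 * f10 ^+ 3 / (f2 * f5))).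
Hypothesis hs1 : hs + 1 != 0.

Local Notation x := hx.
Local Notation s := hs.
Local Notation y := hy.

Lemma hs_neq0 : s != 0.
Proof. by rewrite /hs !(mulf_neq0, invr_neq0, expf_neq0). Qed.
Lemma hy_neq0 : y != 0.
Proof. by rewrite /hy !(mulf_neq0, invr_neq0, expf_neq0). Qed.

(** Here and in the next three lemmas one theta relation is rescaled by an eta quotient. The outcome
    is a factorisation of 1 + x and of 1 - 4x, and two equations linking [s] and [y] to [x]. *)
Lemma hx1E : 1 + x = f2 ^+ 3 * f10 / (f1 * f5 ^+ 3).
Proof.
have := congr1 (fun t => t * (f1 * f10 / (f2 * f5 ^+ 3))) psi_rel.
rewrite [RHS](_ : _ = 1); last by field_nz.
move=> <-; rewrite /hx; field_nz.
Qed.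

Lemma hx4E : 1 - 4 * x = f1 ^+ 4 * f10 ^+ 2 / (f2 ^+ 2 * f5 ^+ 4).
Proof.
have := congr1 (fun t => t * (f10 ^+ 2 / f5 ^+ 4)) phi_rel_tw.
rewrite [RHS](_ : _ = - (4 * x)); last by rewrite /hx; field_nz.
move=> e; rewrite -e; field_nz.
Qed.

Lemma hsE : s = (1 - 4 * x) * y + x.
Proof.
have := congr1 (fun t => t * (f1 * f10 ^+ 7 / (f20 ^+ 2 * f2 * f5 ^+ 7))) psi_rel_tw.
rewrite [RHS](_ : _ = s); last by rewrite /hs; field_nz.
by move=> <-; rewrite hx4E /hx /hy; field_nz.
Qed.

Lemma hsyE : (1 + x) ^+ 2 * s = (1 - 4 * x) * y ^+ 2 * (s + 4 * x).
Proof.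
have := congr1 (fun t => t * ((f5 * f20) ^+ 4 / f10 ^+ 10 *
  (f1 ^+ 4 * f10 ^+ 2 / (f2 ^+ 2 * f5 ^+ 4)) * y ^+ 2 * s)) phi_rel.
rewrite mulrBl [X in X - _](_ : _ = (1 + x) ^+ 2 * s); last first.
  by rewrite hx1E /hs /hy; field_nz.
rewrite [X in _ - X](_ : _ = (1 - 4 * x) * y ^+ 2 * s); last first.
  by rewrite hx4E /hs /hy; field_nz.
rewrite [RHS](_ : _ = (1 - 4 * x) * y ^+ 2 * (4 * x)); last first.
  by rewrite hx4E /hx /hs /hy; field_nz.
by move/eqP; rewrite subr_eq => /eqP ->; ring.
Qed.

(* Eliminating [y] leaves a cubic in [s], which has the spurious root [-1]. *)
Lemma hs_quad : s ^+ 2 - (1 - 2 * x) * s + 4 * x ^+ 3 = 0.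
Proof.
have ey : (1 - 4 * x) * y = s - x by rewrite hsE; ring.
have e : (s - x) ^+ 2 * (s + 4 * x) = (1 + x) ^+ 2 * (1 - 4 * x) * s.
  transitivity ((1 - 4 * x) * ((1 - 4 * x) * y ^+ 2 * (s + 4 * x))).
    by rewrite -ey; ring.
  by rewrite -hsyE; ring.
apply: (mulfI hs1); rewrite mulr0; move/eqP: e; rewrite -subr_eq0 => /eqP <-.
by ring.
Qed.

(** Divided by [u], all terms are rational in [x] and [s]. By [hs_quad], s and 4x^3/s have sum 1 -
    2x and product 4x^3, and only the sum of their squares enters. *)
Lemma level20_weight4_eisenstein :
  q ^+ 2 * (f5 ^+ 10 / f1 ^+ 2) +
    q ^+ 2 * ((f10 ^+ 3 / (f5 * f20)) ^+ 10 / (f2 ^+ 3 / (f1 * f4)) ^+ 2) =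
  2 * (q ^+ 2 * (f2 ^+ 4 * f10 ^+ 4) + 9 * (q ^+ 4 * (f10 ^+ 10 / f2 ^+ 2))
     - 8 * (q ^+ 8 * (f20 ^+ 10 / f4 ^+ 2))).
Proof.
set u := q ^+ 2 * (f5 ^+ 10 / f1 ^+ 2).
rewrite [X in _ + X](_ : _ = u * s ^+ 2); last first.
  by rewrite /u /hs; field_nz.
rewrite [q ^+ 2 * (f2 ^+ 4 * _)](_ : _ = u * ((1 + x) ^+ 2 * (1 - 4 * x))); last first.
  by rewrite hx1E hx4E /u; field_nz.
rewrite [q ^+ 4 * _](_ : _ = u * x ^+ 2); last first.
  by rewrite /u /hx; field_nz.
rewrite [q ^+ 8 * _](_ : _ = u * (x ^+ 6 / s ^+ 2)); last first.
  by rewrite /u /hx /hs; field_nz.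
have s0 := hs_neq0.
have e : s + 4 * x ^+ 3 / s = 1 - 2 * x.
  have := congr1 (fun t => t / s + (1 - 2 * x)) hs_quad.
  by rewrite mul0r add0r => <-; field.
have e2 : s ^+ 2 + 16 * (x ^+ 6 / s ^+ 2) = (1 - 2 * x) ^+ 2 - 8 * x ^+ 3.
  by rewrite -e; field.
transitivity (u * (1 + (s ^+ 2 + 16 * (x ^+ 6 / s ^+ 2)) - 16 * (x ^+ 6 / s ^+ 2))).
  by ring.
by rewrite e2; ring.
Qed.

(** Divided by [u], the terms become rational in [x] and [s] once [y] is eliminated through (1 - 4x)
    y = s - x; what remains is a multiple of the quadratic in [hs_quad]. *)
Lemma level20_weight4_cusp :
  q * (f1 ^+ 4 * f5 ^+ 4) -
    q * ((f2 ^+ 3 / (f1 * f4)) ^+ 4 * (f10 ^+ 3 / (f5 * f20)) ^+ 4) =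
  - (8 * (q ^+ 2 * (f2 ^+ 4 * f10 ^+ 4))) - 16 * (q ^+ 4 * (f4 ^+ 4 * f20 ^+ 4)).
Proof.
set u := q * (f1 ^+ 4 * f5 ^+ 4).
have s0 := hs_neq0; have y0 := hy_neq0.
have x1 : 1 + x != 0.
  by rewrite hx1E !(mulf_neq0, invr_neq0, expf_neq0).
have x4 : 1 - 4 * x != 0.
  by rewrite hx4E !(mulf_neq0, invr_neq0, expf_neq0).
have ey : (1 - 4 * x) * y = s - x by rewrite hsE; ring.
have sx : s - x != 0 by rewrite -ey mulf_neq0.
rewrite [q * (_ * _)](_ : _ = u * ((1 + x) ^+ 3 * s ^+ 2 / (s - x) ^+ 3)); last first.
  rewrite -ey hx1E hx4E /u /hs /hy; field_nz.
rewrite [q ^+ 2 * _](_ : _ = u * (x * (1 + x) / (1 - 4 * x))); last first.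
  by rewrite hx1E hx4E /u /hx; field_nz.
rewrite [q ^+ 4 * _](_ : _ = u * (x ^+ 3 * (s - x) ^+ 3 / ((1 - 4 * x) ^+ 3 * s ^+ 2))); last first.
  rewrite -ey hx4E /u /hx /hs /hy; field_nz.
apply/eqP; rewrite -subr_eq0; apply/eqP.
have q0' := hs_quad.
(* The second factor is the exact quotient of the numerator, over the common denominator shown, by
   the quadratic in [hs_quad]. *)
transitivity (u * ((s ^+ 2 - (1 - 2 * x) * s + 4 * x ^+ 3) *
  (4 * x ^+ 6 + (x ^+ 3 - 2 * x ^+ 4 - 24 * x ^+ 5) * s +
   (- 3 * x ^+ 2 + 11 * x ^+ 3 + 28 * x ^+ 4) * s ^+ 2 +
   (1 - 4 * x - 8 * x ^+ 2 + 16 * x ^+ 3) * s ^+ 3 + 16 * x ^+ 3 * s ^+ 4) /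
  ((s - x) ^+ 3 * s ^+ 2 * (1 - 4 * x) ^+ 3))).
  move: s x s0 x4 sx {q0' ey x1 y0} => S X s0 x4 sx.
  by field; rewrite s0 x4 sx.
by rewrite q0' mul0r mul0r mulr0.
Qed.

End Level20.

(** [g1] and [g5] stand for f_1(-q) and f_5(-q). The hypotheses are cleared of denominators so that
    they can be stated for power series as they are. *)
Lemma level20_identities (K : fieldType) (q f1 f2 f4 f5 f10 f20 g1 g5 : K) :
  [&& f1 != 0, f2 != 0, f4 != 0, f5 != 0, f10 != 0 & f20 != 0] ->
  g1 * (f1 * f4) = f2 ^+ 3 -> g5 * (f5 * f20) = f10 ^+ 3 ->
  f2 ^+ 4 * f5 ^+ 2 * f10 - q * (f10 ^+ 5 * f1 ^+ 2) = f2 * f5 ^+ 5 * f1 ->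
  f2 ^+ 4 * g5 ^+ 2 * f10 + q * (f10 ^+ 5 * g1 ^+ 2) = f2 * g5 ^+ 5 * g1 ->
  f2 ^+ 10 * (f5 * f20) ^+ 4 - f10 ^+ 10 * (f1 * f4) ^+ 4 =
    4 * q * (f2 ^+ 2 * (f5 * f20) ^+ 5 * (f1 * f4) ^+ 3) ->
  f2 ^+ 10 * (g5 * f20) ^+ 4 - f10 ^+ 10 * (g1 * f4) ^+ 4 =
    - (4 * q * (f2 ^+ 2 * (g5 * f20) ^+ 5 * (g1 * f4) ^+ 3)) ->
  f10 ^+ 15 * f1 ^+ 2 * f4 + f5 ^+ 10 * f20 ^+ 5 * f2 ^+ 3 != 0 ->
  q ^+ 2 * (f5 ^+ 10 / f1 ^+ 2) + q ^+ 2 * (g5 ^+ 10 / g1 ^+ 2) =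
    2 * (q ^+ 2 * (f2 ^+ 4 * f10 ^+ 4) + 9 * (q ^+ 4 * (f10 ^+ 10 / f2 ^+ 2))
       - 8 * (q ^+ 8 * (f20 ^+ 10 / f4 ^+ 2))) /\
  q * (f1 ^+ 4 * f5 ^+ 4) - q * (g1 ^+ 4 * g5 ^+ 4) =
    - (8 * (q ^+ 2 * (f2 ^+ 4 * f10 ^+ 4))) - 16 * (q ^+ 4 * (f4 ^+ 4 * f20 ^+ 4)).
Proof.
case/and5P=> f1n f2n f4n f5n /andP[f10n f20n] tw1 tw5 psi psi_tw phi phi_tw ns.
have nz := (f1n, f2n, f4n, f5n, f10n, f20n).
have g1E : g1 = f2 ^+ 3 / (f1 * f4) by rewrite -tw1; field; rewrite ?nz.
have g5E : g5 = f10 ^+ 3 / (f5 * f20) by rewrite -tw5; field; rewrite ?nz.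
have hs1 : hs f1 f2 f4 f5 f10 f20 + 1 != 0.
  rewrite (_ : _ + 1 = (f10 ^+ 15 * f1 ^+ 2 * f4 + f5 ^+ 10 * f20 ^+ 5 * f2 ^+ 3) /
    (f5 ^+ 10 * f20 ^+ 5 * f2 ^+ 3)); last by rewrite /hs; field; rewrite ?nz.
  by rewrite !(mulf_neq0, invr_neq0, expf_neq0).
have psi_rel :
    f2 ^+ 4 / f1 ^+ 2 - q * (f10 ^+ 4 / f5 ^+ 2) = f2 * f5 ^+ 3 / (f1 * f10).
  transitivity ((f2 ^+ 4 * f5 ^+ 2 * f10 - q * (f10 ^+ 5 * f1 ^+ 2)) /
    (f1 ^+ 2 * f5 ^+ 2 * f10)); first by field; rewrite ?nz.
  by rewrite psi; field; rewrite ?nz.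
have psi_rel_tw :
    f1 ^+ 2 * f4 ^+ 2 / f2 ^+ 2 + q * (f5 ^+ 2 * f20 ^+ 2 / f10 ^+ 2) =
    f10 ^+ 8 * f1 * f4 / (f5 ^+ 3 * f20 ^+ 3 * f2 ^+ 2).
  transitivity ((f2 ^+ 4 * g5 ^+ 2 * f10 + q * (f10 ^+ 5 * g1 ^+ 2)) /
    (g1 ^+ 2 * g5 ^+ 2 * f10)); first by rewrite g1E g5E; field; rewrite ?nz.
  by rewrite psi_tw g1E g5E; field; rewrite ?nz.
have phi_rel :
    f2 ^+ 10 / (f1 * f4) ^+ 4 - f10 ^+ 10 / (f5 * f20) ^+ 4 =
    4 * q * (f2 ^+ 2 * f5 * f20 / (f1 * f4)).
  transitivity ((f2 ^+ 10 * (f5 * f20) ^+ 4 - f10 ^+ 10 * (f1 * f4) ^+ 4) /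
    ((f1 * f4) ^+ 4 * (f5 * f20) ^+ 4)); first by field; rewrite ?nz.
  by rewrite phi; field; rewrite ?nz.
have phi_rel_tw :
    f1 ^+ 4 / f2 ^+ 2 - f5 ^+ 4 / f10 ^+ 2 = - (4 * q * (f1 * f10 ^+ 3 / (f2 * f5))).
  transitivity ((f2 ^+ 10 * (g5 * f20) ^+ 4 - f10 ^+ 10 * (g1 * f4) ^+ 4) /
    ((g1 * f4) ^+ 4 * (g5 * f20) ^+ 4)); first by rewrite g1E g5E; field; rewrite ?nz.
  by rewrite phi_tw g1E g5E; field; rewrite ?nz.
split; rewrite g1E g5E.
  exact: (level20_weight4_eisenstein).
exact: (level20_weight4_cusp).
Qed.

Local Notation "x %:F" := (tofrac x).

(** Transfer through the fraction field: the embedding is injective and respects the inverses of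
    units. *)
Lemma level20_identities_domain (R : idomainType) (q f1 f2 f4 f5 f10 f20 g1 g5 : R) :
  all (mem GRing.unit) [:: f1; f2; f4; f5; f10; f20; g1] ->
  g1 * (f1 * f4) = f2 ^+ 3 -> g5 * (f5 * f20) = f10 ^+ 3 ->
  f2 ^+ 4 * f5 ^+ 2 * f10 - q * (f10 ^+ 5 * f1 ^+ 2) = f2 * f5 ^+ 5 * f1 ->
  f2 ^+ 4 * g5 ^+ 2 * f10 + q * (f10 ^+ 5 * g1 ^+ 2) = f2 * g5 ^+ 5 * g1 ->
  f2 ^+ 10 * (f5 * f20) ^+ 4 - f10 ^+ 10 * (f1 * f4) ^+ 4 =
    4 * q * (f2 ^+ 2 * (f5 * f20) ^+ 5 * (f1 * f4) ^+ 3) ->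
  f2 ^+ 10 * (g5 * f20) ^+ 4 - f10 ^+ 10 * (g1 * f4) ^+ 4 =
    - (4 * q * (f2 ^+ 2 * (g5 * f20) ^+ 5 * (g1 * f4) ^+ 3)) ->
  f10 ^+ 15 * f1 ^+ 2 * f4 + f5 ^+ 10 * f20 ^+ 5 * f2 ^+ 3 != 0 ->
  q ^+ 2 * (f5 ^+ 10 / f1 ^+ 2) + q ^+ 2 * (g5 ^+ 10 / g1 ^+ 2) =
    2 * (q ^+ 2 * (f2 ^+ 4 * f10 ^+ 4) + 9 * (q ^+ 4 * (f10 ^+ 10 / f2 ^+ 2))
       - 8 * (q ^+ 8 * (f20 ^+ 10 / f4 ^+ 2))) /\
  q * (f1 ^+ 4 * f5 ^+ 4) - q * (g1 ^+ 4 * g5 ^+ 4) =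
    - (8 * (q ^+ 2 * (f2 ^+ 4 * f10 ^+ 4))) - 16 * (q ^+ 4 * (f4 ^+ 4 * f20 ^+ 4)).
Proof.
move=> /= /and5P[u1 u2 u4 u5 /and4P[u10 u20 v1 _]] tw1 tw5 psi psi_tw phi phi_tw ns.
have inj : injective (fun x : R => x%:F) by move=> x y /eqP; rewrite tofrac_eq => /eqP.
have nz (x : R) : x \is a GRing.unit -> x%:F != 0.
  by move=> ux; rewrite tofrac_eq0; apply: contraTneq ux => ->; rewrite unitr0.
have pushV (x : R) : x \is a GRing.unit -> x^-1%:F = x%:F^-1 by apply: rmorphV.
have push := (tofracB, tofracD, tofracN, tofracXn, tofracM, tofrac1, rmorph_nat).
have [||||||||e1 e2] := @level20_identities {fraction R} q%:F f1%:F f2%:F f4%:F f5%:F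
  f10%:F f20%:F g1%:F g5%:F.
- by rewrite !nz.
- by have := congr1 (@tofrac R) tw1; rewrite !push.
- by have := congr1 (@tofrac R) tw5; rewrite !push.
- by have := congr1 (@tofrac R) psi; rewrite !push.
- by have := congr1 (@tofrac R) psi_tw; rewrite !push.
- by have := congr1 (@tofrac R) phi; rewrite !push.
- by have := congr1 (@tofrac R) phi_tw; rewrite !push.
- by move: ns; rewrite -tofrac_eq0 !push.
split; apply: inj.
  rewrite !push (pushV _ (unitrX 2 u1)) (pushV _ (unitrX 2 u2)).
  by rewrite (pushV _ (unitrX 2 u4)) (pushV _ (unitrX 2 v1)) !push.
by rewrite !push.
Qed.

(** * Even coefficients *)

Lemma thetaE a b : (0 < a + b)%N -> theta a b = pl a (a + b) * pl b (a + b) * fm (a + b).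
Proof. by move=> ab0; rewrite fmE //; apply: jacobi_triple. Qed.

Lemma fm0 m : fm m 0%N = 1.
Proof. by rewrite /fm big_geq // coef1. Qed.

(** By the triple product phi(q) is (pl 1 2)^2 f_2. Splitting [pl 1 2] modulo 10, the class of 5
    belongs to phi(q^5), and the other four form the product [r] of the remaining two theta
    series. *)
Lemma phi_fm :
  fm 2 ^+ 10 * (fm 5 * fm 20) ^+ 4 - fm 10 ^+ 10 * (fm 1 * fm 4) ^+ 4 =
  4 * psq * (fm 2 ^+ 2 * (fm 5 * fm 20) ^+ 5 * (fm 1 * fm 4) ^+ 3).
Proof.
have := phi_theta; rewrite !thetaE //=.
have e1 : pl 1 2 * (fm 1 * fm 4) = fm 2 ^+ 2 by apply: (@pl_odd_fm 1).
have e5 : pl 5 10 * (fm 5 * fm 20) = fm 10 ^+ 2 by apply: (@pl_odd_fm 5).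
have r1 : pl 1 2 = pl 5 10 * (pl 1 10 * pl 3 10 * pl 7 10 * pl 9 10).
  by rewrite (@poch_split 5) // !big_ord_recr big_ord0 /=; ring.
set r := (X in _ * X) in r1; set F1 := fm 1 * fm 4 in e1 *; set F5 := fm 5 * fm 20 in e5 *.
move=> ephi.
have e : pl 1 2 ^+ 4 * fm 2 ^+ 2 = pl 5 10 ^+ 4 * fm 10 ^+ 2 + 4 * psq * (r * fm 10 ^+ 2).
  transitivity ((pl 1 2 * pl 1 2 * fm 2) ^+ 2); first by ring.
  by rewrite ephi /r; ring.
transitivity ((pl 1 2 * F1) ^+ 4 * fm 2 ^+ 2 * F5 ^+ 4
   - (pl 5 10 * F5) ^+ 4 * fm 10 ^+ 2 * F1 ^+ 4); first by rewrite e1 e5; ring.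
transitivity (F1 ^+ 4 * F5 ^+ 4 *
   (pl 1 2 ^+ 4 * fm 2 ^+ 2 - pl 5 10 ^+ 4 * fm 10 ^+ 2)); first by ring.
rewrite e -e5 -e1 r1; ring.
Qed.

(** As for phi, now splitting [pl 1 1] modulo 5. Each two-sided series is twice psi, by [poch0], so
    a common factor 4 is cancelled. *)
Lemma psi_fm :
  fm 2 ^+ 4 * fm 5 ^+ 2 * fm 10 - psq * (fm 10 ^+ 5 * fm 1 ^+ 2) =
  fm 2 * fm 5 ^+ 5 * fm 1.
Proof.
have := psi_theta; rewrite !thetaE //= !poch0 //.
have e1 : pl 1 1 * fm 1 = fm 2 by apply: (@pl_fm 1).
have e5 : pl 5 5 * fm 5 = fm 10 by apply: (@pl_fm 5).
have r1 : pl 1 1 = pl 5 5 * (pl 1 5 * pl 2 5 * pl 3 5 * pl 4 5).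
  by rewrite (@poch_split 5) // !big_ord_recr big_ord0 /=; ring.
set r := (X in _ * X) in r1 => epsi.
have e : 4 * (pl 1 1 ^+ 4 * fm 1 ^+ 2) =
    4 * (psq * (pl 5 5 ^+ 4 * fm 5 ^+ 2) + r * fm 5 ^+ 2).
  transitivity ((pl 1 1 * (2 * pl 1 1) * fm 1) ^+ 2); first by ring.
  by rewrite epsi /r; ring.
have n4 : (4 : pser) != 0.
  by apply/eqP => /(congr1 (fun f : pser => f 0%N))/eqP.
move/(mulfI n4): e => e.
transitivity ((pl 1 1 * fm 1) ^+ 4 * fm 5 ^+ 2 * fm 10
   - psq * ((pl 5 5 * fm 5) ^+ 4 * fm 10 * fm 1 ^+ 2)); first by rewrite e1 e5; ring.
transitivity (fm 1 ^+ 2 * fm 5 ^+ 2 * fm 10 *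
   (pl 1 1 ^+ 4 * fm 1 ^+ 2 - psq * (pl 5 5 ^+ 4 * fm 5 ^+ 2))); first by ring.
rewrite e -e5 -e1 r1; ring.
Qed.

(** * From the level 20 relations to the theorem *)

Lemma qcoef_shift f d n : qcoef f (n%:Z - d%:Z) = (psq ^+ d * f) n.
Proof.
rewrite psqXM; case: leqP => [le_dn|lt_nd]; first by rewrite subzn.
have : n%:Z - d%:Z < 0 by lia.
by case: (n%:Z - d%:Z).
Qed.

Lemma psdivE (f g : pser) : g 0%N = 1 -> psdiv f g = f / g.
Proof.
move=> g0; rewrite /psdiv -[psmul _ _]/(f * _); congr (_ * _).
by rewrite -[RHS]/(psinvr g) /psinvr /psunit g0 oner_neq0.
Qed.

(** [cuspF] and [eisH] are F and H. Coefficient N of [eisH] is A_5(N - 2), so the index 2^k n +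
    2^(k+1) - 2 of the theorem becomes 2^k (n + 2). *)
Definition cuspF : pser := psq * (fm 1 ^+ 4 * fm 5 ^+ 4).
Definition eisH : pser := psq ^+ 2 * (fm 5 ^+ 10 / fm 1 ^+ 2).

Lemma fmX_unit m k : fm m ^+ k \is a GRing.unit.
Proof. by rewrite unfold_in /= /psunit psX0 fm0 expr1n oner_neq0. Qed.

Lemma dilate2_fmX m k : (0 < m)%N -> dilate2 (fm m ^+ k) = fm (2 * m) ^+ k.
Proof. by move=> m0; rewrite rmorphXn /= dilate2_fm. Qed.

Lemma dilate2_cuspF : dilate2 cuspF = psq ^+ 2 * (fm 2 ^+ 4 * fm 10 ^+ 4).
Proof.
by rewrite /cuspF rmorphM [X in _ * X]rmorphM /= dilate2_psq !dilate2_fmX.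
Qed.

Lemma dilate2_dilate2_cuspF :
  dilate2 (dilate2 cuspF) = psq ^+ 4 * (fm 4 ^+ 4 * fm 20 ^+ 4).
Proof.
rewrite dilate2_cuspF rmorphM [X in _ * X]rmorphM rmorphXn /= dilate2_psq.
by rewrite !dilate2_fmX // -exprM.
Qed.

Lemma dilate2_eisH : dilate2 eisH = psq ^+ 4 * (fm 10 ^+ 10 / fm 2 ^+ 2).
Proof.
rewrite /eisH rmorphM [X in _ * X]rmorphM rmorphXn rmorphV ?fmX_unit //=.
rewrite dilate2_psq !dilate2_fmX //.
by rewrite -exprM.
Qed.

Lemma dilate2_dilate2_eisH :
  dilate2 (dilate2 eisH) = psq ^+ 8 * (fm 20 ^+ 10 / fm 4 ^+ 2).
Proof.
rewrite dilate2_eisH rmorphM [X in _ * X]rmorphM rmorphXn rmorphV ?fmX_unit //=.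
by rewrite dilate2_psq !dilate2_fmX // -exprM.
Qed.


Lemma level20_relations :
  eisH + twist eisH = 2 * (dilate2 cuspF + 9 * dilate2 eisH - 8 * dilate2 (dilate2 eisH)) /\
  cuspF + twist cuspF = - (8 * dilate2 cuspF) - 16 * dilate2 (dilate2 cuspF).
Proof.
rewrite dilate2_dilate2_cuspF dilate2_cuspF dilate2_dilate2_eisH dilate2_eisH.
have tw1 := @twist_fm_odd 1 isT; have tw5 := @twist_fm_odd 5 isT.
rewrite -[(4 * 1)%N]/4%N -[(2 * 1)%N]/2%N in tw1.
rewrite -[(4 * 5)%N]/20%N -[(2 * 5)%N]/10%N in tw5.
have twE : twist eisH = psq ^+ 2 * (twist (fm 5) ^+ 10 / twist (fm 1) ^+ 2).
  rewrite /eisH rmorphM [X in _ * X]rmorphM rmorphV ?fmX_unit // !rmorphXn /= twist_psq.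
  by rewrite sqrrN.
have twC : twist cuspF = - (psq * (twist (fm 1) ^+ 4 * twist (fm 5) ^+ 4)).
  by rewrite /cuspF rmorphM [X in _ * X]rmorphM !rmorphXn /= twist_psq mulNr.
(* Applying q -> -q to the two theta identities supplies the other two relations. *)
have psi_tw := congr1 twist psi_fm; have phi_tw := congr1 twist phi_fm.
rewrite !(rmorphB, rmorphXn, rmorphM, rmorph_nat) /= twist_psq in psi_tw phi_tw.
rewrite !(@twist_fm_even 2, @twist_fm_even 4, @twist_fm_even 10, @twist_fm_even 20) //
  in psi_tw phi_tw.
rewrite twE twC; apply: level20_identities_domain => //.
- have fu m : fm m \is a GRing.unit by have := fmX_unit m 1; rewrite expr1.
  by rewrite /= !fu (rmorph_unit twist).
- exact: psi_fm.
- by rewrite -psi_tw; ring.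
- exact: phi_fm.
- by rewrite phi_tw; ring.
(* The constant term of this sum is 1 + 1, so it is nonzero and the root -1 is excluded. *)
apply/eqP => /(congr1 (fun f : pser => f 0%N))/eqP.
by rewrite psD !psM0 !psX0 !fm0.
Qed.

Lemma even_coef_eisH n : eisH n.*2 = cuspF n + 9 * eisH n - 8 * dilate2 eisH n.
Proof.
have [e _] := level20_relations.
have := congr1 (fun f : pser => f n.*2) e; rewrite /=.
rewrite psD ps_natrM psB psD !ps_natrM !dilate2_double /twist -signr_odd odd_double.
lra.
Qed.

Lemma even_coef_cuspF n : cuspF n.*2 = - 4 * cuspF n - 8 * dilate2 cuspF n.
Proof.
have [_ e] := level20_relations.
have := congr1 (fun f : pser => f n.*2) e; rewrite /=.
rewrite psD psB psN !ps_natrM !dilate2_double /twist -signr_odd odd_double.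
lra.
Qed.

(** The induction applies U once more. As U undoes V, the old V terms return F and H, and the new
    coefficient of F is the recursion defining [B]. *)
Lemma eisH_coef k n : eisH (2 ^ k.+1 * n)%N =
  B k.+1 * cuspF n - 8 * B k * dilate2 cuspF n + (8 ^+ k.+2 - 1) / 7 * eisH n
  - (8 ^+ k.+2 - 8) / 7 * dilate2 eisH n.
Proof.
elim: k n => [|k IH] n.
  by rewrite expn1 mul2n even_coef_eisH /=; field.
rewrite expnSr -mulnA mul2n IH !dilate2_double even_coef_eisH even_coef_cuspF.
have -> : B k.+2 = -4 * B k.+1 - 8 * B k + (8 ^+ k.+2 - 1) / 7 by [].
by rewrite [8 ^+ k.+3]exprS; field.
Qed.

(* Coefficientwise: for every integer n >= -1, the coefficient of q^n of both
   sides agree (for n < -1 both sides have coefficient 0 trivially). *)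
Theorem theorem1p1 (k : nat) (hk : (1 <= k)%N) (n : int) (hn : -1 <= n) :
  qcoef A5gf (2 ^+ k * n + 2 ^+ k.+1 - 2) =
    B k * qcoef (psmul (pspow (fm 1) 4) (pspow (fm 5) 4)) (n + 1)
  - 8 * B k.-1 * qcoef (psmul (pspow (fm 2) 4) (pspow (fm 10) 4)) n
  + (8 ^+ k.+1 - 1) / 7 * qcoef (psdiv (pspow (fm 5) 10) (pspow (fm 1) 2)) n
  - (8 ^+ k.+1 - 8) / 7 * qcoef (psdiv (pspow (fm 10) 10) (pspow (fm 2) 2)) (n - 2).
Proof.
case: k hk => // k _.
(* With m = n + 2 every index becomes m - d, so all terms are coefficients at m of series multiplied
   by q^d; these are F, V H and their companions. *)
have [m ->] : exists m : nat, n = m%:Z - 2%:Z by exists (absz (n + 2)); lia.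
have -> : 2 ^+ k.+1 * (m%:Z - 2%:Z) + 2 ^+ k.+2 - 2 = (2 ^ k.+1 * m)%N%:Z - 2%:Z.
  by rewrite PoszM -(natz (2 ^ k.+1)) natrX !exprS; ring.
have -> : m%:Z - 2%:Z + 1 = m%:Z - 1%:Z by lia.
have -> : m%:Z - 2%:Z - 2 = m%:Z - 4%:Z by lia.
have pX0 (l j : nat) : (fm l ^+ j) 0%N = 1 by rewrite psX0 fm0 expr1n.
rewrite /A5gf !pspowE !psdivE // !qcoef_shift.
rewrite -[psmul (fm 1 ^+ 4) _]/(fm 1 ^+ 4 * _) -[psmul (fm 2 ^+ 4) _]/(fm 2 ^+ 4 * _).
by rewrite expr1 -dilate2_cuspF -dilate2_eisH; exact: eisH_coef.
Qed.
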